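(* Let $r\ge 1$ be an integer and $q\ge 2$ a prime power. Write $\mathrm{P}_n=q^{\binom{r+n}{r}-1}\,\frac{1-q^{-\binom{r-1+n}{r-1}}}{1-q^{-1}}$ for $n\ge 0$, and let $\mathrm{I}_n=\#I_{r,n}(\mathbb{F}_q)$ and $\mathrm{R}_n=\#R_{r,n}(\mathbb{F}_q)$. Then $\mathrm{I}_0=0$, $\mathrm{R}_0=1$, and for all $n\ge 1$ $$\mathrm{I}_n=-\sum_{k\mid n}\frac{\mu(k)}{k}\sum_{j\in M_{n/k}}\frac{(-1)^{|j|}}{|j|}\,\mathrm{P}_{j_1}\mathrm{P}_{j_2}\cdots \mathrm{P}_{j_{|j|}},$$ $$\mathrm{R}_n=\mathrm{P}_n+\sum_{k\mid n}\frac{\mu(k)}{k}\sum_{j\in M_{n/k}}\frac{(-1)^{|j|}}{|j|}\,\mathrm{P}_{j_1}\mathrm{P}_{j_2}\cdots \mathrm{P}_{j_{|j|}}.$$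
   Context: $\mathbb{F}_q$ is the finite field with $q$ elements. Fix a monomial order (say degree-lexicographic) on $\mathbb{F}_q[x_1,\dots,x_r]$; a polynomial is monic if its leading coefficient is $1$. $P_{r,n}(\mathbb{F}_q)$ is the set of monic polynomials in $\mathbb{F}_q[x_1,\dots,x_r]$ of total degree exactly $n$ (its cardinality is $\mathrm{P}_n$). $I_{r,n}(\mathbb{F}_q)\subseteq P_{r,n}(\mathbb{F}_q)$ is the subset of irreducible polynomials, and $R_{r,n}(\mathbb{F}_q)=P_{r,n}(\mathbb{F}_q)\setminus I_{r,n}(\mathbb{F}_q)$; by convention $I_{r,0}(\mathbb{F}_q)=\varnothing$ and $R_{r,0}(\mathbb{F}_q)=\{1\}$. $\mu$ is the number-theoretic Möbius function. For a positive integer $m$, $M_m$ is the set of compositions of $m$, i.e. finite sequences $j=(j_1,\dots,j_{|j|})$ of positive integers with $j_1+\dots+j_{|j|}=m$, where $|j|$ denotes the length of the sequence. *)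

(* Defs.v *)
From HB Require Import structures.
From mathcomp Require Import all_boot all_order all_algebra finmap.
From mathcomp Require Import boolp classical_sets functions cardinality fsbigop.
From mathcomp Require Import mpoly.

Import GRing.Theory.

Local Open Scope classical_set_scope.
Local Open Scope ring_scope.

Definition irreducible_elt {D : idomainType} (p : D) : Prop :=
  [/\ p != 0, p \isn't a GRing.unit &
      forall a b : D, p = a * b -> a \is a GRing.unit \/ b \is a GRing.unit].

(* [mlead] is taken for the order [mnmc_le], which compares [mdeg m :: m]
   lexicographically: this is the degree-lexicographic order (the header of
   mpoly.v calls it degrevlex).  [msize p] is 1 + the total degree of [p], and
   0 for [p = 0].  The two conventions in degree 0 need no special case: the
   only monic polynomial of total degree 0 is the unit 1. *)
Definition monic_polys (F : finFieldType) (r n : nat) : set {mpoly F[r]} :=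
  [set p | mleadc p = 1 /\ msize p = n.+1].

Definition irreducible_polys (F : finFieldType) (r n : nat) :
    set {mpoly F[r]} :=
  monic_polys F r n `&` [set p | irreducible_elt p].

Definition reducible_polys (F : finFieldType) (r n : nat) :
    set {mpoly F[r]} :=
  monic_polys F r n `\` irreducible_polys F r n.

Definition compositions (m : nat) : set (seq nat) :=
  [set j | all (leq 1) j /\ sumn j = m].

(* Only meaningful for n > 0. *)
Definition moebius (n : nat) : int :=
  if has (fun p => p ^ 2 %| n)%N (primes n) then 0
  else (-1) ^+ size (primes n).

(* Since 'C(r + n, r) > 0, the truncated predecessor is harmless. *)
Definition monic_count (q r n : nat) : rat :=
  q%:R ^+ 'C(r + n, r).-1
  * ((1 - q%:R ^- 'C(r - 1 + n, r - 1)) / (1 - q%:R ^-1)).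

(* [fset_set] and [\sum_(_ \in _)] take default values on infinite sets; the
   lemmas below show that this does not happen here. *)
Lemma finite_monic_polys (F : finFieldType) (r n : nat) :
  finite_set (monic_polys F r n).
Proof.
pose f (c : {ffun 'X_{1..r < n.+1} -> F}) : {mpoly F[r]} :=
  \sum_(m : 'X_{1..r < n.+1}) c m *: 'X_[m].
apply: (@sub_finite_set _ _ (f @` setT)); last exact/finite_image/finite_finset.
move=> p [_ sz_p]; exists [ffun m : 'X_{1..r < n.+1} => p@_m] => //.
rewrite [RHS](mpolywE (k := n.+1)) ?sz_p // /f.
by apply: eq_bigr => m _; rewrite ffunE.
Qed.

Lemma finite_irreducible_polys (F : finFieldType) (r n : nat) :
  finite_set (irreducible_polys F r n).
Proof. by apply: sub_finite_set (finite_monic_polys F r n) => p []. Qed.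

Lemma finite_reducible_polys (F : finFieldType) (r n : nat) :
  finite_set (reducible_polys F r n).
Proof. exact/finite_setD/finite_monic_polys. Qed.

Lemma finite_compositions (m : nat) : finite_set (compositions m).
Proof.
pose f (b : m.-bseq 'I_m.+1) := [seq val i | i <- b].
apply: (@sub_finite_set _ _ (f @` setT)); last exact/finite_image/finite_finset.
move=> j [j_gt0 sum_j].
have le_size : (size j <= m)%N.
  rewrite -sum_j; elim: j j_gt0 {sum_j} => //= x s IHs /andP[x_gt0 /IHs le_s].
  by rewrite -add1n leq_add.
have lt_j i : i \in j -> (i < m.+1)%N.
  rewrite ltnS -sum_j => /perm_to_rem /perm_sumn-> /=; exact: leq_addr.
have sz : (size [seq inord i : 'I_m.+1 | i <- j] <= m)%N by rewrite size_map.
exists (Bseq sz) => //; rewrite /f /= -map_comp -[RHS]map_id.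
by apply/eq_in_map => i /lt_j lt_i /=; rewrite inordK.
Qed.

(* Main.v *)
Require Import Defs.
From HB Require Import structures.
From mathcomp Require Import all_boot all_order all_algebra finmap.
From mathcomp Require Import boolp classical_sets functions cardinality fsbigop.
From mathcomp Require Import mpoly.
From mathcomp Require Import zify ring.

(* F[x_1..x_r] is a unique factorization domain: by Gauss's lemma every
   irreducible element of D[x] is prime as soon as D has this property, and one
   adds the variables one at a time. Hence the degree of a monic polynomial f is
   the sum of deg p over the pairs (p, e) with p monic irreducible, e >= 1 and
   p^e | f. Summing over all monic f of degree n gives
     n P_n = \sum_(1 <= m <= n) L_m P_(n-m)   with   L_m = \sum_(d | m) d I_d,
   that is, \sum_m L_m X^m = X A' / A for A = \sum_n P_n X^n. Expanding log A
   gives L_m as a sum over compositions of m, and Moebius inversion recovers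
   I_n. *)

Set Implicit Arguments.
Unset Strict Implicit.
Unset Printing Implicit Defensive.

Import GRing.Theory Num.Theory.

Local Open Scope classical_set_scope.
Local Open Scope ring_scope.

(** * Gauss's lemma: primality of irreducibles passes from D to D[X] *)

Definition divides {D : idomainType} (a b : D) : Prop := exists c, b = a * c.

Definition irreducibles_prime (D : idomainType) : Prop :=
  forall p a b : D, irreducible_elt p ->
  divides p (a * b) -> divides p a \/ divides p b.

(* Every nonzero element is a unit times a product of irreducibles, stated as
   an induction principle. *)
Definition atomic (D : idomainType) : Prop :=
  forall P : D -> Prop,
    (forall u, u \is a GRing.unit -> P u) ->
    (forall p a, irreducible_elt p -> P a -> P (p * a)) ->
  forall a, a != 0 -> P a.

Section GaussLemma.
Variable D : idomainType.
Hypotheses (Dprime : irreducibles_prime D) (Datomic : atomic D).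

Implicit Types (p c : D) (a b f g h : {poly D}).

(** Primality of [p] in [D] makes [p] divide one of the two leading coefficients. Removing that
    leading term changes the product by a multiple of [p], so induction on the sum of the sizes
    applies. *)
Lemma polyC_prime p a b : irreducible_elt p ->
  divides p%:P (a * b) -> divides p%:P a \/ divides p%:P b.
Proof.
move=> irr_p; have [n] := ubnP (size a + size b)%N.
elim: n a b => // n IHn.
have lead_case a b : (size a + size b < n.+1)%N -> a != 0 ->
    divides p (lead_coef a) ->
    divides p%:P (a * b) -> divides p%:P a \/ divides p%:P b.
  move=> le_ab nz_a [c lc] [e ab].
  (* [a'] is [a] without its leading term [(c *: 'X^m) * p%:P]. *)
  pose m := (size a).-1; pose a' := take_poly m a.
  have def_a : a = a' + (c *: 'X^m) * p%:P.
    rewrite -[LHS](poly_take_drop m); congr (_ + _).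
    rewrite -mul_polyC [RHS]mulrC mulrA -polyCM -lc; congr (_ * _).
    apply/polyP => i; rewrite coef_drop_poly coefC /lead_coef addnC.
    case: i => [|i] /=; first by rewrite addn0.
    by rewrite nth_default // /m addnS -addSn prednK ?size_poly_gt0 // leq_addr.
  have lt_a' : (size a' < size a)%N.
    by rewrite (leq_ltn_trans (size_take_poly _ _)) // prednK ?size_poly_gt0.
  have [||[d da']|] := IHn a' b; last by right.
  - by rewrite -ltnS (leq_trans _ le_ab) // ltnS ltn_add2r.
  - exists (e - c *: 'X^m * b); rewrite mulrBr -ab [in RHS]def_a mulrDl.
    by rewrite mulrCA !mulrA addrK.
  by left; exists (d + c *: 'X^m); rewrite mulrDr -da' [_%:P * (_ *: _)]mulrC.
move=> a b le_ab.
have [->|nz_a] := eqVneq a 0; first by left; exists 0; rewrite mulr0.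
have [->|nz_b] := eqVneq b 0; first by right; exists 0; rewrite mulr0.
move=> dvd_ab.
have [|dv|dv] := Dprime (a := lead_coef a) (b := lead_coef b) irr_p.
- have [e /(congr1 lead_coef)] := dvd_ab.
  by rewrite !lead_coefM lead_coefC => ->; exists (lead_coef e).
- exact: lead_case.
- by apply/or_comm/lead_case => //; rewrite 1?addnC // mulrC.
Qed.

(** Atomicity does the work of contents: the irreducible factors of [c] are cancelled one at a time.
    Such a factor divides [f * e] but not [f], which is irreducible and nonconstant, so it divides
    the cofactor [e]. *)
Lemma divides_scale f g c : irreducible_elt f -> (1 < size f)%N -> c != 0 ->
  divides f (c *: g) -> divides f g.
Proof.
move=> [nz_f nu_f irr_f] sz_f nz_c; move: c nz_c g.
apply: Datomic => [u Uu|p c irr_p IHc] g [e].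
  move=> def_e; exists (u^-1 *: e).
  by rewrite -scalerAr -def_e scalerA mulVr // scale1r.
move=> fe; have [nz_p nu_p _] := irr_p.
have [|[f' def_f]|[e' def_e]] := polyC_prime (a := f) (b := e) irr_p.
- by exists (c *: g); rewrite -fe mul_polyC scalerA.
- case: (irr_f _ _ def_f); first by rewrite poly_unitE coefC (negPf nu_p) andbF.
  rewrite poly_unitE => /andP[/eqP sz _]; move: sz_f.
  by rewrite def_f mul_polyC size_scale // sz.
apply: IHc; exists e'; have nzp : p%:P != 0 by rewrite polyC_eq0.
apply: (mulfI nzp); rewrite mul_polyC scalerA fe def_e.
by rewrite !mulrA [f * _]mulrC.
Qed.

(** Brings a factorization over the fraction field back to [D]. Each irreducible factor of [c]
    divides [a] or [b] and is cancelled there; being a constant, it affects no size. *)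
Lemma factor_scale f a b c : c != 0 -> c *: f = a * b ->
  exists a' b', [/\ f = a' * b', size a' = size a & size b' = size b].
Proof.
move=> nz_c; move: c nz_c f a b.
apply: Datomic => [u Uu f a b def_f|p c irr_p IHc f a b def_f].
  exists (u^-1 *: a), b; split=> //; last first.
    by rewrite size_scale // invr_eq0; apply: contraTneq Uu => ->; rewrite unitr0.
  by rewrite -scalerAl -def_f scalerA mulVr // scale1r.
have [nz_p _ _] := irr_p.
have nzp : p%:P != 0 by rewrite polyC_eq0.
have [|[a' def_a]|[b' def_b]] := polyC_prime (a := a) (b := b) irr_p.
- by exists (c *: f); rewrite -def_f mul_polyC scalerA.
- have [|a1 [b1 [-> sz_a sz_b]]] := IHc f a' b.
    by apply: (mulfI nzp); rewrite mul_polyC scalerA def_f def_a mulrA.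
  by exists a1, b1; rewrite def_a mul_polyC size_scale.
have [|a1 [b1 [-> sz_a sz_b]]] := IHc f a b'.
  by apply: (mulfI nzp); rewrite mul_polyC scalerA def_f def_b mulrCA.
by exists a1, b1; rewrite def_b mul_polyC size_scale.
Qed.

Import Pdiv.Idomain.

(** In [irreducible_poly], divisibility is up to a nonzero constant, so the conclusion is
    irreducibility over the fraction field; [factor_scale] pulls a factorization there back to
    [D]. *)
Lemma irreducible_elt_poly f :
  irreducible_elt f -> (1 < size f)%N -> irreducible_poly f.
Proof.
move=> [nz_f nu_f irr_f] sz_f; split=> // q sz_q.
move=> /Pdiv.WeakIdomain.dvdpP[[c s] /= nz_c def_f].
have [s' [q' [def_f' sz_s' sz_q']]] := factor_scale nz_c def_f.
case: (irr_f _ _ def_f'); rewrite poly_unitE => /andP[/eqP sz _]; last first.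
  by rewrite -sz_q' sz in sz_q.
have /size_poly1P[s0 nz_s0 def_s] : size s == 1%N by rewrite -sz_s' sz.
apply/eqpP; exists (s0, c); rewrite /= ?nz_s0 //.
by rewrite def_f def_s mul_polyC.
Qed.

(** A nonconstant [f] is prime over the fraction field by a gcd argument, and [divides_scale]
    returns to D[X]. A constant [f] comes from an irreducible of [D], which is the case of
    [polyC_prime]. *)
Lemma poly_irreducibles_prime : irreducibles_prime {poly D}.
Proof.
move=> f g h irr_f dvd_gh; have [nz_f nu_f irrf] := irr_f.
case: (ltngtP (size f) 1%N) => [|sz_f|/eqP/size_poly1P[c nz_c def_f]].
- by rewrite ltnS leqn0 size_poly_eq0 (negPf nz_f).
- have of_dvdp k : f %| k -> divides f k.
    move=> /Pdiv.WeakIdomain.dvdpP[[c s] /= nz_c def_k].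
    by apply: (divides_scale irr_f sz_f nz_c); exists s; rewrite mulrC.
  have irrP := irreducible_elt_poly irr_f sz_f.
  have [/of_dvdp|ndvd] := boolP (f %| g); first by left.
  have cop : coprimep f g.
    rewrite /coprimep; apply: contraNT ndvd => /irrP/(_ (dvdp_gcdl _ _)) eqf.
    by rewrite -(eqp_dvdl _ eqf) dvdp_gcdr.
  right; apply: of_dvdp; rewrite -(Gauss_dvdpr _ cop).
  by case: dvd_gh => e ->; apply: dvdp_mulr.
move: dvd_gh; rewrite def_f; apply: polyC_prime; split=> // [|a b def_c].
  by apply: contra nu_f; rewrite def_f poly_unitE size_polyC nz_c coefC.
have := irrf a%:P b%:P; rewrite def_f def_c polyCM => /(_ erefl).
by rewrite !poly_unitE !coefC => -[] /andP[_ ?]; [left|right].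
Qed.

End GaussLemma.

(** * Factorization in several variables over a field *)

Lemma mpoly_unitE (F : fieldType) n (p : {mpoly F[n]}) :
  (p \is a GRing.unit) = (msize p == 1%N).
Proof.
have -> : (p \is a GRing.unit) = (p == (p@_0)%:MP) && (p@_0 \in GRing.unit).
  by [].
apply/andP/idP => [[/eqP def_p Uc]|/msize_poly1P[c nz_c ->]].
  by rewrite def_p msizeC; move: Uc; rewrite unitfE => ->.
by rewrite mcoeffC eqxx mulr1 unitfE.
Qed.

(** Provides the decreasing measure for factoring: over a field, a nonzero nonunit has positive
    degree. *)
Lemma msizeM_nunit (F : fieldType) n (a b : {mpoly F[n]}) :
  a * b != 0 -> a \isn't a GRing.unit -> (msize b < msize (a * b))%N.
Proof.
rewrite mulf_eq0 mpoly_unitE => /norP[nz_a nz_b] sz_a.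
rewrite msizeM //; move: nz_a; rewrite -msize_poly_eq0.
by case: (msize a) sz_a => [|[|k]] // _ _; rewrite addSn /= addSn ltnS leq_addl.
Qed.

Lemma mpoly_irreducible_factor (F : fieldType) n (a : {mpoly F[n]}) :
  a != 0 -> a \isn't a GRing.unit ->
  exists p b, irreducible_elt p /\ a = p * b.
Proof.
have [m] := ubnP (msize a); elim: m a => // m IHm a le_a nz_a nu_a.
have [irr_a|red_a] := pselect (irreducible_elt a).
  by exists a, 1; rewrite mulr1.
have [[[b c] /= [def_a nu_b nu_c]]|no_fact] := pselect
  (exists bc : _ * _, [/\ a = bc.1 * bc.2, bc.1 \isn't a GRing.unit
                        & bc.2 \isn't a GRing.unit]); last first.
  case: red_a; split=> // b c def_a.
  have [Ub|nu_b] := boolP (b \is a GRing.unit); first by left.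
  have [Uc|nu_c] := boolP (c \is a GRing.unit); first by right.
  by case: no_fact; exists (b, c).
have nz_b : b != 0 by apply: contraNneq nz_a => b0; rewrite def_a b0 mul0r.
have [|//|//|p [d [irr_p def_b]]] := IHm b.
  apply: (@leq_trans (msize a)) => //.
  by rewrite def_a mulrC msizeM_nunit // mulrC -def_a.
by exists p, (d * c); rewrite mulrA -def_b.
Qed.

Lemma mpoly_atomic (F : fieldType) n : atomic {mpoly F[n]}.
Proof.
move=> P P_unit P_mul a; have [m] := ubnP (msize a).
elim: m a => // m IHm a le_a nz_a.
have [/P_unit //|nu_a] := boolP (a \is a GRing.unit).
have [p [b [irr_p def_a]]] := mpoly_irreducible_factor nz_a nu_a.
have nz_b : b != 0 by apply: contraNneq nz_a => b0; rewrite def_a b0 mulr0.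
rewrite def_a; apply: P_mul => //; apply: IHm => //.
apply: (@leq_trans (msize a)) => //.
rewrite def_a msizeM_nunit -?def_a //.
by case: irr_p.
Qed.

(** Meant for [muni]. Preimages of inverses and of cofactors exist, so [phi] reflects units and
    divisibility. *)
Lemma irreducibles_prime_transfer (A B : idomainType) (phi : {rmorphism A -> B}) :
  injective phi -> (forall b, exists a, phi a = b) ->
  irreducibles_prime B -> irreducibles_prime A.
Proof.
move=> phi_inj phi_surj B_prime p a b [nz_p nu_p irr_p].
have phi_unit x : phi x \is a GRing.unit -> x \is a GRing.unit.
  move=> Ux; have [y phi_y] := phi_surj (phi x)^-1.
  apply/unitrPr; exists y; apply: phi_inj.
  by rewrite rmorphM phi_y mulrV // rmorph1.
have phi_dvd x y : divides (phi x) (phi y) -> divides x y.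
  case=> z; have [c <-] := phi_surj z.
  by rewrite -rmorphM => /phi_inj->; exists c.
have irr_phi : irreducible_elt (phi p).
  split=> [||x y]; first by rewrite -(rmorph0 phi) (inj_eq phi_inj).
    by apply: contra nu_p; apply: phi_unit.
  have [[x' <-] [y' <-]] := (phi_surj x, phi_surj y).
  rewrite -rmorphM => /phi_inj/irr_p.
  by case=> /(rmorph_unit phi) ?; [left|right].
case=> c def_ab; have [||] := B_prime _ (phi a) (phi b) irr_phi.
- by exists (phi c); rewrite -!rmorphM def_ab.
- by move/phi_dvd; left.
by move/phi_dvd; right.
Qed.

(** A monomial [m] is determined by its exponent in the last variable and its restriction [m'] to
    the others, so [p@_m] can be read off [muni p]. *)
Lemma muni_inj (R : nzRingType) n : injective (@muni n R).
Proof.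
move=> p q eq_pq; apply/eqP; rewrite -subr_eq0; apply/eqP.
have {eq_pq}: muni (p - q) = 0 by rewrite raddfB /= eq_pq subrr.
move: (p - q) => {p q} p p0; apply/mpolyP => m; rewrite mcoeff0.
pose m' := [multinom (m (widen_ord (leqnSn n) i)) | i < n].
have [m_p|/memN_msupp_eq0 //] := boolP (m \in msupp p).
have : (muni p)`_(m ord_max) @_m' = 0 by rewrite p0 coef0 mcoeff0.
rewrite muniE coef_sum raddf_sum (bigD1_seq m) //= big1 ?addr0 => [<-|k nk_m].
  by rewrite coefZ coefXn eqxx mulr1 mcoeffZ mcoeffX eqxx mulr1.
rewrite coefZ coefXn; case: eqP => [eq_max|_]; last by rewrite mulr0 mcoeff0.
rewrite mulr1 mcoeffZ mcoeffX; case: eqP => [eq_m|_]; last by rewrite mulr0.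
case/eqP: nk_m; apply/mnmP => i.
have [lt_in|ge_in] := ltnP i n.
  have /mnmP/(_ (Ordinal lt_in)) := eq_m; rewrite !mnmE.
  by rewrite (_ : widen_ord _ _ = i) //; apply: val_inj.
suff -> : i = ord_max by [].
by apply/val_inj/eqP; rewrite eqn_leq ge_in -ltnS ltn_ord.
Qed.

(** [muni] sends the last variable to ['X] and a widened [q] to the constant [q%:P]; substituting
    the last variable for ['X] in [p] therefore gives a preimage. *)
Lemma muni_surj (R : comNzRingType) n (p : {poly {mpoly R[n]}}) :
  exists q, muni q = p.
Proof.
have muniX : muni 'X_ord_max = 'X :> {poly {mpoly R[n]}}.
  rewrite muniE msuppX big_seq1 mcoeffX eqxx scale1r mnm1E eqxx expr1.
  rewrite (_ : [multinom _ | i < n] = 0%MM) ?mpolyX0 ?scale1r //.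
  apply/mnmP => i; rewrite mnmE mnm0E mnm1E -val_eqE /=.
  by rewrite eq_sym ltn_eqF.
have muniW (q : {mpoly R[n]}) : muni (mwiden q) = q%:P.
  elim/mpolyind: q => [|c m q _ _ IHq]; first by rewrite mwiden0 muni0 polyC0.
  rewrite mwidenD muniD IHq polyCD mwidenZ mwidenX muniZ muniE msuppX big_seq1.
  rewrite mcoeffX eqxx scale1r mnmwiden_ordmax expr0 -!mul_polyC mulr1 -polyCM.
  rewrite mul_mpolyC. congr ((_ *: 'X_[_])%:P + _).
  by apply/mnmP => i; rewrite mnmE mnmwiden_widen.
exists (mmulti p); rewrite raddf_sum /= -[RHS]coefK poly_def.
by apply: eq_bigr => i _; rewrite rmorphM rmorphXn /= muniX muniW mul_polyC.
Qed.

Lemma mpoly_irreducibles_prime (F : fieldType) n :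
  irreducibles_prime {mpoly F[n]}.
Proof.
elim: n => [|n IHn].
  (* Without variables every nonzero polynomial is a constant, hence a unit, and there are no
     irreducibles. *)
  move=> p a b [nz_p /negP[]]; rewrite mpoly_unitE.
  have def_p : p = (p@_0)%:MP.
    apply/mpolyP => m; rewrite mcoeffC (_ : m = 0%MM) ?eqxx ?mulr1 //.
    by apply/mnmP; case.
  by rewrite def_p msizeC; move: nz_p; rewrite {1}def_p mpolyC_eq0 => ->.
apply: (@irreducibles_prime_transfer _ _ (@muni n F)).
- exact: muni_inj.
- exact: muni_surj.
exact: poly_irreducibles_prime IHn (@mpoly_atomic F n).
Qed.

(** * Monic irreducible factors and their multiplicities *)

Section UniqueFactorization.
Variables (D : idomainType).
Hypothesis Dprime : irreducibles_prime D.
Implicit Types p q a : D.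

Lemma divides_exp_mulr p q a e : irreducible_elt p -> ~ divides p q ->
  divides (p ^+ e) (q * a) -> divides (p ^+ e) a.
Proof.
move=> irr_p ndvd_pq; have [nz_p _ _] := irr_p.
elim: e a => [|e IHe] a; first by exists a; rewrite mul1r.
case=> c def_qa; have [|//|[b def_a]] := @Dprime p q a irr_p.
  by exists (p ^+ e * c); rewrite mulrA -exprS.
have [|d def_b] := IHe b; last by exists d; rewrite exprS -mulrA -def_b.
by exists c; apply: (mulfI nz_p); rewrite [RHS]mulrA -exprS -def_qa def_a mulrCA.
Qed.

End UniqueFactorization.

Section MonicPolys.
Variables (F : finFieldType) (r : nat).
Local Notation monic := (monic_polys F r).
Local Notation irred := (irreducible_polys F r).
Implicit Types (f g p q : {mpoly F[r]}) (d e k n N : nat).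

(* [msizeM] goes through the idomain structure of [F]; [lia] would treat the
   resulting [msize]s as distinct from the ones in the context. *)
Let msizeMF f g : f != 0 -> g != 0 -> msize (f * g) = (msize f + msize g).-1.
Proof. exact: msizeM. Qed.

Lemma monic_polys_neq0 n f : monic n f -> f != 0.
Proof. by case=> _ sz_f; rewrite -msize_poly_eq0 sz_f. Qed.

Lemma monic_polysM m n f g : monic m f -> monic n g -> monic (m + n)%N (f * g).
Proof.
move=> mf mg; have nz_f := monic_polys_neq0 mf; have nz_g := monic_polys_neq0 mg.
case: mf mg => [lf sf] [lg sg]; split.
  by rewrite mleadcM_proper lf lg mulr1 ?oner_eq0.
by rewrite msizeMF // sf sg addnS.
Qed.

Lemma monic_polysX n f e : monic n f -> monic (e * n)%N (f ^+ e).
Proof.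
move=> mf; elim: e => [|e IHe]; last by rewrite exprS mulSn; apply: monic_polysM.
by rewrite mul0n expr0; split; rewrite ?mleadc1 ?msize1.
Qed.

Lemma monic_polys_cancel m n f g : monic m f -> monic n (f * g) ->
  (m <= n)%N /\ monic (n - m)%N g.
Proof.
move=> mf mfg; have nz_fg := monic_polys_neq0 mfg.
have /norP[nz_f nz_g] : ~~ ((f == 0) || (g == 0)) by rewrite -mulf_eq0.
have [lf sf] := mf; case: mfg.
rewrite mleadcM_proper ?lf ?mul1r ?mleadc_eq0 // => lg.
move: (nz_g); rewrite msizeMF // sf -msize_poly_eq0 => sz_g def_n.
by split; [lia|split=> //; lia].
Qed.

(** Mutual divisibility forces equal degrees, so the cofactor is a constant; comparing leading
    coefficients makes it 1. *)
Lemma monic_associate m n f g : monic m f -> monic n g ->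
  divides f g -> divides g f -> f = g.
Proof.
move=> mf mg [a def_g] [b def_f].
have [le_mn ma] : (m <= n)%N /\ monic (n - m)%N a.
  by apply: monic_polys_cancel mf _; rewrite -def_g.
have [le_nm _] : (n <= m)%N /\ monic (m - n)%N b.
  by apply: monic_polys_cancel mg _; rewrite -def_f.
case: ma => la sa; rewrite def_g.
suff -> : a = 1 by rewrite mulr1.
have /eqP/msize_poly1P[c _ def_a] : msize a = 1%N by apply: etrans sa _; lia.
by move: la; rewrite def_a mleadcC => ->.
Qed.

Lemma irreducible_polys_divides d d' p q :
  irred d p -> irred d' q -> divides p q -> p = q.
Proof.
move=> [mp [_ nu_p _]] [mq [_ _ irr_q]] [a def_q].
apply: (monic_associate mp mq); first by exists a.
case: (irr_q _ _ def_q) => [Up|Ua]; first by rewrite Up in nu_p.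
by exists a^-1; rewrite def_q mulrK.
Qed.

Lemma irreducible_polys_gt0 d p : irred d p -> (0 < d)%N.
Proof.
case=> [[_ sz_p] [_ nu_p _]]; move: nu_p.
by rewrite mpoly_unitE sz_p; case: d {sz_p}.
Qed.

Lemma irreducible_polys_normalize p : irreducible_elt p ->
  exists c p0, [/\ c != 0, p = c *: p0 & irred (msize p).-1 p0].
Proof.
move=> [nz_p nu_p irr_p]; pose c := mleadc p.
have nz_c : c != 0 by rewrite mleadc_eq0.
exists c, (c^-1 *: p); rewrite scalerA mulfV // scale1r; split=> //.
have Uc : (c^-1)%:MP_[r] \is a GRing.unit.
  by rewrite mpoly_unitE msizeC invr_eq0 nz_c.
split.
  split; first by rewrite mleadcZE mulVf.
  by rewrite msizeZ ?invr_eq0 // prednK // lt0n msize_poly_eq0.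
split; rewrite -?mul_mpolyC ?unitrM ?Uc //.
  by rewrite mulf_neq0 // mpolyC_eq0 invr_eq0.
move=> a b def_p; case: (irr_p (c%:MP * a) b).
- by rewrite -mulrA -def_p mulrA -mpolyCM mulfV // mul1r.
- by rewrite unitrM => /andP[]; left.
by right.
Qed.

Lemma irreducible_polys_inj d d' p : irred d p -> irred d' p -> d = d'.
Proof. by move=> [[_ sp] _] [[_ sp'] _]; apply: succn_inj; rewrite -sp. Qed.

(** Boolean so that it can be summed: for [p] irreducible and [f] nonzero of degree at most [N], its
    sum over [e] from 1 to [N] is the multiplicity of [p] in [f]. *)
Definition pow_divides p e f : bool := `[< divides (p ^+ e) f >].

(** If [p] differs from [p0], it does not divide [p0], and [p0] cancels by primality. If [p = p0],
    the powers shift by one and the exponent 0 contributes the extra 1. *)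
Lemma sum_pow_divides_mul p0 p c a N d d0 :
  irred d p -> irred d0 p0 -> c != 0 -> p0 * a != 0 -> (msize (p0 * a) <= N.+1)%N ->
  (\sum_(1 <= e < N.+1) pow_divides p e (c *: p0 * a)
   = \sum_(1 <= e < N.+1) pow_divides p e a + (p == p0))%N.
Proof.
move=> irr_p irr_p0 nz_c nz_p0a le_N.
have /norP[nz_p0 nz_a] : ~~ ((p0 == 0) || (a == 0)) by rewrite -mulf_eq0.
have scaleE e : pow_divides p e (c *: p0 * a) = pow_divides p e (p0 * a).
  rewrite -scalerAl; apply/asboolP/asboolP => -[b def_b].
    exists (c^-1 *: b).
    by rewrite -scalerAr -def_b scalerA mulVf // scale1r.
  by exists (c *: b); rewrite -scalerAr -def_b.
rewrite (eq_bigr _ (fun e _ => congr1 nat_of_bool (scaleE e))).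
have [eq_p|ne_p] := eqVneq p p0; last first.
  rewrite addn0; apply: eq_bigr => e _; congr nat_of_bool.
  apply/asboolP/asboolP => [|[b ->]]; last by exists (p0 * b); rewrite mulrCA.
  apply: divides_exp_mulr; [exact: mpoly_irreducibles_prime|by case: irr_p|].
  by move/(irreducible_polys_divides irr_p irr_p0)/eqP; rewrite (negPf ne_p).
rewrite -{p0 irr_p0 nz_p0 scaleE}eq_p in nz_p0a le_N *.
have shiftE e : pow_divides p e.+1 (p * a) = pow_divides p e a.
  apply/asboolP/asboolP => -[b def_b].
    exists b; apply: (mulfI (monic_polys_neq0 irr_p.1)).
    by rewrite def_b exprS mulrA.
  by exists b; rewrite def_b exprS mulrA.
rewrite big_add1 /= (eq_bigr (fun e => pow_divides p e a : nat)) => [|e _]; last first.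
  by rewrite shiftE.
have N_gt0 : (0 < N)%N.
  move: le_N; rewrite msizeMF ?(monic_polys_neq0 irr_p.1) // irr_p.1.2.
  have := irreducible_polys_gt0 irr_p; move: nz_a; rewrite -msize_poly_eq0.
  lia.
have pow0_divides : pow_divides p 0 a by apply/asboolP; exists a; rewrite mul1r.
rewrite big_ltn // pow0_divides addnC; congr addn.
(* The shifted sum stops before [N], so the term [e = N] on the right has to vanish: if [p ^+ N]
   divided [a], then [p * a] would have degree above [N]. *)
rewrite [RHS]big_nat_recr //= [X in _ = (_ + X)%N](_ : _ = 0%N) ?addn0 //.
apply/eqP; rewrite eqb0; apply/asboolPn => -[b1].
set b : {mpoly F[r]} := b1 => def_a.
move: le_N; rewrite def_a mulrA -exprS.
have nz_b : b != 0 by apply: contraNneq nz_a => b0; rewrite def_a b0 mulr0.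
have mpN := monic_polysX N.+1 irr_p.1; rewrite msizeMF ?(monic_polys_neq0 mpN) //.
rewrite mpN.2; have := leq_pmulr N.+1 (irreducible_polys_gt0 irr_p).
move: nz_b; rewrite -msize_poly_eq0; lia.
Qed.

(** Induction along a factorization. For a unit both sides are 0; multiplying by an irreducible with
    monic associate [p0] raises only the multiplicity of [p0], so both sides grow by the degree of
    [p0]. *)
Lemma degree_sum_factors N f : f != 0 -> (msize f <= N.+1)%N ->
  ((msize f).-1 = \sum_(1 <= d < N.+1) \sum_(p <- fset_set (irred d))
                    \sum_(1 <= e < N.+1) d * pow_divides p e f)%N.
Proof.
(* Nonzeroness is duplicated: [mpoly_atomic] consumes one copy, the other stays in the induction
   predicate. *)
move=> nz_f; move: (nz_f); move: f nz_f.
apply: mpoly_atomic => [u Uu _ _|p a irr_p IHa nz_pa le_N].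
  move: (Uu); rewrite mpoly_unitE => /eqP-> /=; apply/esym.
  rewrite big1_seq // => d _; rewrite big1_seq // => p /andP[_].
  rewrite in_fset_set; last exact: finite_irreducible_polys.
  rewrite inE => irr_p; rewrite big1_seq // => e /andP[_].
  rewrite mem_index_iota => /andP[e_gt0 _].
  apply/eqP; rewrite muln_eq0 eqb0; apply/orP; right; apply/asboolPn => -[b def_u].
  have [_ [_ nu_p _]] := irr_p; case/negP: nu_p.
  by move: Uu; rewrite def_u -(prednK e_gt0) exprS -mulrA unitrM => /andP[].
have [c [p0 [nz_c def_p irr_p0]]] := irreducible_polys_normalize irr_p.
have nz_a : a != 0 by apply: contraNneq nz_pa => ->; rewrite mulr0.
move: (msize p).-1 irr_p0 => d0 irr_p0.
have nz_p0 := monic_polys_neq0 irr_p0.1.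
have sz_p0 := irr_p0.1.2.
have sz_pa : msize (p * a) = msize (p0 * a).
  by rewrite def_p -scalerAl msizeZ.
have sz_a : (msize a).-1.+1 = msize a by rewrite prednK // lt0n msize_poly_eq0.
have nz_p0a : p0 * a != 0 by rewrite mulf_neq0.
have d0_gt0 := irreducible_polys_gt0 irr_p0.
have szM := msizeMF nz_p0 nz_a.
rewrite sz_pa in le_N *.
(* The degree [d0] of [p0] is spread as an indicator over all pairs of a degree and an irreducible,
   to be added termwise. *)
transitivity ((msize a).-1 + \sum_(1 <= d < N.+1) \sum_(p1 <- fset_set (irred d))
   d * (p1 == p0))%N; last first.
  rewrite (IHa nz_a); last by lia.
  rewrite -big_split /=; apply: eq_bigr => d _; rewrite -big_split /=.
  apply: eq_big_seq => p1.
  rewrite in_fset_set; last exact: finite_irreducible_polys.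
  rewrite inE => irr_p1.
  rewrite -!big_distrr -mulnDr /= def_p; congr muln; apply/esym.
  exact: sum_pow_divides_mul irr_p1 irr_p0 nz_c nz_p0a le_N.
have le_d0N : (d0 <= N)%N by move: le_N; rewrite szM sz_p0 -sz_a; lia.
have d0_in : d0 \in index_iota 1 N.+1 by rewrite mem_index_iota d0_gt0.
have p0_in : p0 \in fset_set (irred d0).
  by rewrite in_fset_set ?inE //; apply: finite_irreducible_polys.
rewrite (bigD1_seq d0) ?iota_uniq //= (bigD1_seq p0) ?fset_uniq //=.
rewrite eqxx muln1 big1 ?addn0 => [|p1 /negPf->]; last by rewrite muln0.
rewrite big1_seq ?addn0 => [|d /andP[ne_d _]].
  by rewrite szM sz_p0 -sz_a addSn addnS addnC.
rewrite big1_seq // => p1; rewrite in_fset_set; last exact: finite_irreducible_polys.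
rewrite inE => irr_p1; case: eqP => [eq_p|]; last by rewrite muln0.
by case/eqP: ne_d; apply: irreducible_polys_inj irr_p0; rewrite -eq_p.
Qed.

End MonicPolys.

(** * Double counting of degrees over all monic polynomials *)

Section Count.
Variables (F : finFieldType) (r : nat).
Local Notation monic := (monic_polys F r).
Local Notation irred := (irreducible_polys F r).
Implicit Types (f g p q : {mpoly F[r]}) (d e k n N : nat).

Lemma mem_fset_monic n f : (f \in fset_set (monic n)) = `[< monic n f >].
Proof.
rewrite in_fset_set; last exact: finite_monic_polys.
by apply/idP/asboolP; rewrite inE.
Qed.

Lemma mem_fset_irred n f : (f \in fset_set (irred n)) = `[< irred n f >].
Proof.
rewrite in_fset_set; last exact: finite_irreducible_polys.
by apply/idP/asboolP; rewrite inE.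
Qed.

(** Multiplication by [f] is a bijection from the monic polynomials of degree [n - m] onto these
    multiples. The factor [m <= n] guards the truncated subtraction. *)
Lemma count_multiples m n f : monic m f ->
  (\sum_(g <- fset_set (monic n)) `[< divides f g >]
   = (m <= n) * #|` fset_set (monic (n - m))|)%N.
Proof.
move=> mf; have nz_f := monic_polys_neq0 mf.
rewrite -big_mkcond /= sum1_count -size_filter.
have [le_mn|lt_nm] := leqP m n; last first.
  rewrite mul0n; apply/eqP; rewrite size_eq0 -[_ == _]negbK -has_filter.
  apply/hasPn => g; rewrite mem_fset_monic => /asboolP mg.
  apply/asboolPn => -[b def_g]; rewrite def_g in mg.
  by have [] := monic_polys_cancel mf mg; rewrite leqNgt lt_nm.
rewrite mul1n -(size_map (fun h => f * h) (fset_set (monic (n - m)))).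
apply/perm_size/uniq_perm; rewrite ?filter_uniq ?fset_uniq //.
  by rewrite map_inj_uniq ?fset_uniq //; apply: mulfI.
move=> g; rewrite mem_filter mem_fset_monic; apply/andP/mapP.
  case=> /asboolP[h ->] /asboolP mg; exists h => //.
  by rewrite mem_fset_monic; apply/asboolP; have [] := monic_polys_cancel mf mg.
case=> h; rewrite mem_fset_monic => /asboolP mh ->; split; apply/asboolP.
  by exists h.
by rewrite -(subnKC le_mn); apply: monic_polysM.
Qed.

(** Both sides are the sum of the degrees of all monic [f] of degree [n]: on the right each degree
    is expanded by [degree_sum_factors], and the multiples of each [p ^+ e] are counted. *)
Lemma monic_count_rec n :
  (n * #|` fset_set (monic n)| =
   \sum_(1 <= d < n.+1) \sum_(1 <= e < n.+1 | e * d <= n)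
     d * #|` fset_set (irred d)| * #|` fset_set (monic (n - e * d))|)%N.
Proof.
transitivity (\sum_(f <- fset_set (monic n)) (msize f).-1)%N.
  rewrite mulnC -sum1_size big_distrl /=; apply: eq_big_seq => f.
  by rewrite mem_fset_monic mul1n => /asboolP[_ ->].
transitivity (\sum_(f <- fset_set (monic n)) \sum_(1 <= d < n.+1)
  \sum_(p <- fset_set (irred d)) \sum_(1 <= e < n.+1) d * pow_divides p e f)%N.
  apply: eq_big_seq => f; rewrite mem_fset_monic => /asboolP mf.
  by apply: degree_sum_factors; [apply: monic_polys_neq0 mf|rewrite mf.2].
rewrite exchange_big /=; apply: eq_bigr => d _.
rewrite exchange_big /=.
transitivity (\sum_(p <- fset_set (irred d)) \sum_(1 <= e < n.+1 | e * d <= n)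
    d * #|` fset_set (monic (n - e * d))|)%N.
  apply: eq_big_seq => p; rewrite mem_fset_irred => /asboolP irr_p.
  rewrite exchange_big /= [RHS]big_mkcond /=; apply: eq_bigr => e _.
  rewrite -big_distrr /= (count_multiples _ (monic_polysX e irr_p.1)).
  by case: leqP; rewrite ?muln0 ?mul1n.
rewrite exchange_big /=; apply: eq_bigr => e _.
rewrite big_const_seq count_predT iter_addn_0 mulnAC //.
Qed.

(** The [L_m] of the overview. *)
Definition irred_weight m : nat :=
  (\sum_(d <- divisors m) d * #|` fset_set (irred d)|)%N.

Lemma monic_count_convolution n :
  (n * #|` fset_set (monic n)| =
   \sum_(1 <= m < n.+1) irred_weight m * #|` fset_set (monic (n - m))|)%N.
Proof.
rewrite monic_count_rec /irred_weight; apply/esym.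
transitivity (\sum_(1 <= m < n.+1) \sum_(1 <= d < n.+1 | d %| m)
   d * #|` fset_set (irred d)| * #|` fset_set (monic (n - m))|)%N.
  apply: eq_big_nat => m /andP[m_gt0 le_mn].
  rewrite big_distrl /= -[RHS]big_filter; apply: perm_big.
  apply: uniq_perm; rewrite ?divisors_uniq ?filter_uniq ?iota_uniq //.
  move=> d; rewrite -dvdn_divisors // mem_filter mem_index_iota.
  apply/idP/andP => [dvd_dm|[]//]; split=> //.
  by rewrite (dvdn_gt0 m_gt0) // (leq_ltn_trans (dvdn_leq _ dvd_dm)).
(* For fixed [d], the map sending [e] to [e * d] enumerates the multiples [m] of [d] up to [n]. *)
rewrite (exchange_big_dep_nat predT) //=; apply: eq_big_nat => d /andP[d_gt0 _].
rewrite -[RHS]big_filter -[LHS]big_filter.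
rewrite -(big_map (fun e => e * d)%N xpredT
  (fun m => d * #|` fset_set (irred d)| * #|` fset_set (monic (n - m))|)%N).
apply: perm_big; apply: uniq_perm.
- by rewrite filter_uniq // iota_uniq.
- rewrite map_inj_uniq ?filter_uniq ?iota_uniq // => e e'.
  by move/eqP; rewrite eqn_pmul2r // => /eqP.
move=> m; rewrite mem_filter mem_index_iota.
apply/idP/mapP => [/andP[/dvdnP[e ->] /andP[ed_gt0 le_n]]|[e]].
  exists e => //; rewrite mem_filter mem_index_iota -ltnS le_n /=.
  move: ed_gt0; rewrite muln_gt0 => /andP[e_gt0 _]; rewrite e_gt0 /=.
  by rewrite (leq_ltn_trans _ le_n) // leq_pmulr.
rewrite mem_filter mem_index_iota => /andP[le_n /andP[e_gt0 _]] ->.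
by rewrite dvdn_mull //= muln_gt0 e_gt0 d_gt0 ltnS.
Qed.

End Count.

(** * The number of monic polynomials of given degree *)

(** Pascal's rule: monomials of degree at most [k] are those of degree below [k] together with the
    [basis] of degree [k]. *)
Lemma card_bmultinom r k : #|{: 'X_{1..r.+1 < k}}| = 'C(r + k, r.+1).
Proof.
pose M j := [seq val m | m : 'X_{1..r.+1 < j}].
have memM j m : (m \in M j) = (mdeg m < j)%N.
  apply/mapP/idP => [[b _ ->]|lt_m]; first exact: bmdeg.
  by exists (BMultinom lt_m); rewrite ?mem_enum.
have uniqM j : uniq (M j) by rewrite map_inj_uniq ?enum_uniq //; apply: val_inj.
have sizeM j : size (M j) = #|{: 'X_{1..r.+1 < j}}| by rewrite size_map -cardE.
rewrite -sizeM; elim: k => [|k IHk].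
  rewrite addn0 bin_small //; apply/eqP; rewrite size_eq0.
  by case eqM: (M 0%N) => [|m s] //; have := memM 0%N m; rewrite eqM mem_head.
have binE : 'C(r + k, r) = 'C(k + r, k).
  by rewrite [(r + k)%N]addnC -[RHS]bin_sub ?leq_addr // addKn.
rewrite addnS binS -IHk binE -(size_basis r k) -size_cat.
apply/perm_size/uniq_perm => //; last first.
  by move=> m; rewrite mem_cat -basis_cover !memM ltnS leq_eqVlt orbC.
rewrite cat_uniq uniqM uniq_basis andbT; apply/hasPn => m.
by rewrite -basis_cover memM => /eqP->; rewrite ltnn.
Qed.

Section Cardinality.
Variables (F : finFieldType) (r : nat).
Local Notation monic := (monic_polys F r).

Lemma enum_msize_le k : exists s : seq {mpoly F[r]},
  [/\ uniq s, forall p, (p \in s) = (msize p <= k)%N &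
      size s = (#|F| ^ #|{: 'X_{1..r < k}}|)%N].
Proof.
pose f (c : {ffun 'X_{1..r < k} -> F}) : {mpoly F[r]} := \sum_m c m *: 'X_[m].
have fE c (m : 'X_{1..r < k}) : (f c)@_m = c m.
  rewrite raddf_sum (bigD1 m) //= mcoeffZ mcoeffX eqxx mulr1.
  rewrite big1 ?addr0 // => m' ne_m; rewrite mcoeffZ mcoeffX.
  by rewrite (inj_eq val_inj) (negPf ne_m) mulr0.
exists [seq f c | c : {ffun 'X_{1..r < k} -> F}]; split.
- rewrite map_inj_uniq ?enum_uniq // => c c' eq_f; apply/ffunP => m.
  by rewrite -!fE eq_f.
- move=> p; apply/mapP/idP => [[c _ ->]|sz_p]; last first.
    exists [ffun m : 'X_{1..r < k} => p@_m]; rewrite ?mem_enum //.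
    by rewrite [LHS](mpolywE sz_p); apply: eq_bigr => m _; rewrite ffunE.
  apply: leq_trans (msize_sum _ _ _) _; apply/bigmax_leqP => m _.
  by rewrite (leq_trans (msizeZ_le _ _)) // msizeX bmdeg.
by rewrite size_map -cardE card_ffun.
Qed.

End Cardinality.

(** A polynomial of degree at most [n] either has degree below [n] (or is 0), or is [c *: f] for a
    unique nonzero [c] and a unique monic [f] of degree [n]. *)
Lemma card_monic (F : finFieldType) r n :
  (#|F| ^ 'C(r + n.+1, r.+1) = #|F| ^ 'C(r + n, r.+1)
     + #|F|.-1 * #|` fset_set (monic_polys F r.+1 n)|)%N.
Proof.
rewrite -!card_bmultinom.
have [s1 [uniq_s1 mem_s1 <-]] := enum_msize_le F r.+1 n.+1.
have [s0 [uniq_s0 mem_s0 <-]] := enum_msize_le F r.+1 n.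
have -> : (#|F|.-1 * #|` fset_set (monic_polys F r.+1 n)|)%N =
    size [seq c *: f | c <- enum [pred c : F | c != 0],
                       f <- fset_set (monic_polys F r.+1 n)].
  by rewrite size_allpairs -cardE -(cardC1 (0 : F)).
rewrite -size_cat; apply/perm_size/uniq_perm => //.
  rewrite cat_uniq uniq_s0 allpairs_uniq ?enum_uniq ?fset_uniq ?andbT //=.
  - apply/hasPn => p /allpairsP[[c f] /=]; rewrite mem_enum inE.
    rewrite mem_fset_monic => -[nz_c /asboolP[_ sz_f] ->].
    by rewrite mem_s0 msizeZ // sz_f ltnn.
  move=> [c f] [c' f'] /allpairsP[[c1 f1] /= [nz_c mf [-> ->]]].
  move=> /allpairsP[[c2 f2] /= [nz_c' mf' [-> ->]]] eq_cf.
  move: nz_c nz_c' mf mf'; rewrite !mem_enum !inE !mem_fset_monic.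
  move=> nz_c nz_c' /asboolP[lf _] /asboolP[lf' _].
  have eq_c : c1 = c2.
    by have := congr1 (fun p => mleadc p) eq_cf; rewrite !mleadcZE lf lf' !mulr1.
  by move: eq_cf; rewrite eq_c => /(scalerI nz_c') ->.
move=> p; rewrite mem_cat mem_s1 mem_s0 leq_eqVlt ltnS orbC; congr (_ || _).
apply/eqP/allpairsP => [sz_p|[[c f] /=]].
  have nz_p : p != 0 by rewrite -msize_poly_eq0 sz_p.
  have nz_c : mleadc p != 0 by rewrite mleadc_eq0.
  exists (mleadc p, (mleadc p)^-1 *: p); rewrite /= scalerA mulfV // scale1r.
  rewrite mem_enum inE nz_c mem_fset_monic; split=> //; apply/asboolP; split.
    by rewrite mleadcZE mulVf.
  by rewrite msizeZ ?invr_eq0.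
rewrite mem_enum inE mem_fset_monic => -[nz_c /asboolP[_ sz_f] ->].
by rewrite msizeZ.
Qed.

(** After multiplication by [q * (1 - q^-1)], Pascal's rule on the exponents reduces the closed
    formula to [card_monic]. *)
Lemma monic_countE (F : finFieldType) r n :
  monic_count #|F| r.+1 n = #|` fset_set (monic_polys F r.+1 n)|%:R.
Proof.
set q := #|F|; set M := #|` _|.
have q_gt1 : (1 < q)%N by apply: card_finNzRing_gt1.
have nz_q : q%:R != 0 :> rat by rewrite pnatr_eq0 -lt0n ltnW.
have nz_q1 : 1 - q%:R^-1 != 0 :> rat.
  by rewrite subr_eq0 eq_sym invr_eq1 pnatr_eq1 neq_ltn q_gt1 orbT.
rewrite /monic_count subSS subn0 addSnnS.
have C_gt0 : (0 < 'C(r + n.+1, r.+1))%N by rewrite bin_gt0 addnS ltnS leq_addr.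
apply: (mulIf nz_q1); rewrite -mulrA divfK //.
apply: (mulfI nz_q); rewrite mulrA -exprS prednK //.
have := congr1 (fun k => k%:R : rat) (card_monic F r n).
rewrite -/q -/M natrD natrM !natrX addnS binS exprD => eqM.
rewrite mulrBr mulr1 mulfK ?expf_neq0 // eqM addrC addKr.
rewrite [RHS]mulrCA mulrBr mulr1 mulfV // -subn1 natrB ?mulr1 1?ltnW //.
by rewrite mulrC.
Qed.

(** * Moebius function and Moebius inversion *)

Lemma perm_primesM p d : prime p -> (0 < d)%N -> ~~ (p %| d)%N ->
  perm_eq (primes (p * d)) (p :: primes d).
Proof.
move=> p_pr d_gt0 ndvd_pd; apply: uniq_perm; rewrite ?primes_uniq //=.
  by rewrite mem_primes (negPf ndvd_pd) !andbF primes_uniq.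
by move=> l; rewrite primesM ?(prime_gt0 p_pr) // primes_prime // !inE.
Qed.

Lemma moebius_prime_mul p d : prime p -> (0 < d)%N -> ~~ (p %| d)%N ->
  moebius (p * d) = - moebius d.
Proof.
move=> p_pr d_gt0 ndvd_pd; rewrite /moebius.
have perm_pd := perm_primesM p_pr d_gt0 ndvd_pd.
rewrite (perm_has _ perm_pd) (perm_size perm_pd) /=.
have -> : (p ^ 2 %| p * d)%N = false.
  by rewrite expnS expn1 dvdn_pmul2l ?prime_gt0 // (negPf ndvd_pd).
have -> : has (fun l => l ^ 2 %| p * d)%N (primes d)
         = has (fun l => l ^ 2 %| d)%N (primes d).
  apply: eq_in_has => l; rewrite mem_primes => /and3P[l_pr _ dvd_ld].
  rewrite Gauss_dvdr // coprimeXl // prime_coprime // dvdn_prime2 //.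
  by apply: contraNneq ndvd_pd => <-.
by rewrite orFb exprS mulN1r; case: ifP; rewrite ?oppr0.
Qed.

Lemma moebius_square p d : prime p -> (0 < d)%N -> (p ^ 2 %| d)%N ->
  moebius d = 0.
Proof.
move=> p_pr d_gt0 dvd_pd; rewrite /moebius; case: hasP => // -[]; exists p => //.
rewrite mem_primes p_pr d_gt0 (dvdn_trans _ dvd_pd) //.
by rewrite expnS dvdn_mulr.
Qed.

(** For a prime divisor [p] of [n], divisors divisible by [p ^ 2] contribute 0, and every divisor
    [d] prime to [p] cancels against [p * d]. *)
Lemma sum_moebius n : (0 < n)%N -> \sum_(d <- divisors n) moebius d = (n == 1%N)%:R.
Proof.
move=> n_gt0; have [->|n_neq1] := eqVneq n 1%N; first by rewrite big_seq1.
pose p := pdiv n.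
have p_pr : prime p by apply: pdiv_prime; rewrite ltn_neqAle eq_sym n_neq1.
have dvd_pn : (p %| n)%N by apply: pdiv_dvd.
rewrite (bigID (fun d => p %| d)%N) /= -big_filter.
set s := [seq d <- divisors n | ~~ (p %| d)%N].
set t := filter _ _.
have t_gt0 d : d \in t -> (0 < d)%N.
  by rewrite mem_filter -dvdn_divisors // => /andP[_ /(dvdn_gt0 n_gt0)].
rewrite -[X in _ + X]big_filter -/s.
suff -> : \sum_(d <- t) moebius d = - \sum_(d <- s) moebius d by rewrite addNr.
rewrite (bigID (fun d => p ^ 2 %| d)%N) /= big1_seq ?add0r; last first.
  by move=> d /andP[dvd_pd /t_gt0 d_gt0]; apply: moebius_square p_pr d_gt0 dvd_pd.
rewrite -big_filter -sumrN.
rewrite [RHS](eq_big_seq (fun d => moebius (p * d))); last first.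
  move=> d; rewrite mem_filter -dvdn_divisors // => /andP[ndvd dvd_dn].
  by rewrite moebius_prime_mul // (dvdn_gt0 n_gt0).
rewrite -(big_map (fun d => p * d)%N xpredT moebius).
apply: perm_big; apply: uniq_perm.
- by rewrite !filter_uniq // divisors_uniq.
- rewrite map_inj_uniq ?filter_uniq ?divisors_uniq // => d e.
  by move/eqP; rewrite eqn_pmul2l ?prime_gt0 // => /eqP.
move=> l; rewrite !mem_filter -dvdn_divisors //.
apply/and3P/mapP => [[nsq dvd_pl dvd_ln]|[d]].
  have [d def_l] := dvdnP dvd_pl; exists d; last by rewrite mulnC.
  rewrite mem_filter -dvdn_divisors // (dvdn_trans _ dvd_ln) ?andbT; last first.
    by rewrite def_l dvdn_mulr.
  by apply: contra nsq; rewrite def_l expnS expn1 dvdn_pmul2r ?prime_gt0.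
rewrite mem_filter -dvdn_divisors // => /andP[ndvd dvd_dn] ->.
split; first by rewrite expnS expn1 dvdn_pmul2l ?prime_gt0.
  by rewrite dvdn_mulr.
by rewrite Gauss_dvd ?dvd_pn // prime_coprime.
Qed.

(** After substituting [g] and exchanging sums, the coefficient of [f d] is the sum of [moebius]
    over the divisors of [n %/ d], which is 0 unless [d = n]. *)
Lemma moebius_inversion (R : comPzRingType) (f g : nat -> R) n : (0 < n)%N ->
  (forall m, (0 < m)%N -> g m = \sum_(d <- divisors m) f d) ->
  f n = \sum_(k <- divisors n) (moebius k)%:~R * g (n %/ k)%N.
Proof.
move=> n_gt0 def_g; apply/esym.
transitivity (\sum_(k <- divisors n) \sum_(d <- divisors n | (k * d %| n)%N)
   (moebius k)%:~R * f d).
  apply: eq_big_seq => k; rewrite -dvdn_divisors // => dvd_kn.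
  have k_gt0 := dvdn_gt0 n_gt0 dvd_kn.
  have nk_gt0 : (0 < n %/ k)%N by rewrite divn_gt0 // dvdn_leq.
  rewrite def_g // big_distrr /= -[RHS]big_filter; apply: perm_big.
  apply: uniq_perm; rewrite ?filter_uniq ?divisors_uniq // => d.
  rewrite mem_filter -!dvdn_divisors // dvdn_divRL // mulnC.
  apply/idP/andP => [dvd_kd|[]//]; split=> //.
  exact: dvdn_trans (dvdn_mull _ (dvdnn d)) dvd_kd.
rewrite (exchange_big_dep predT) //=.
transitivity (\sum_(d <- divisors n) (n == d)%:R * f d).
  apply: eq_big_seq => d; rewrite -dvdn_divisors // => dvd_dn.
  have d_gt0 := dvdn_gt0 n_gt0 dvd_dn.
  have nd_gt0 : (0 < n %/ d)%N by rewrite divn_gt0 // dvdn_leq.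
  rewrite -big_distrl /=; congr (_ * _).
  have -> : (n == d) = (n %/ d == 1)%N by rewrite [RHS]eq_sym eqn_div // mul1n eq_sym.
  transitivity ((\sum_(k <- divisors (n %/ d)) moebius k)%:~R : R); last first.
    by rewrite sum_moebius // rmorph_nat.
  rewrite rmorph_sum /= -big_filter; apply: perm_big.
  apply: uniq_perm; rewrite ?filter_uniq ?divisors_uniq // => k.
  rewrite mem_filter -!dvdn_divisors // dvdn_divRL //.
  apply/andP/idP => [[]//|dvd_kd]; split=> //.
  exact: dvdn_trans (dvdn_mulr _ (dvdnn k)) dvd_kd.
rewrite (bigD1_seq n) ?divisors_uniq ?divisors_id //= eqxx mul1r.
by rewrite big1 ?addr0 // => d; rewrite eq_sym => /negPf->; rewrite mul0r.
Qed.

(** * Compositions as coefficients of powers of a generating function *)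

Fixpoint compositions_of_size (l m : nat) : seq (seq nat) :=
  if l is l'.+1 then
    [seq i :: j | i <- index_iota 1 m.+1, j <- compositions_of_size l' (m - i)]
  else if m == 0%N then [:: [::]] else [::].

Lemma mem_compositions_of_size l m j :
  (j \in compositions_of_size l m)
  = [&& size j == l, all (leq 1) j & sumn j == m].
Proof.
elim: l m j => [|l IHl] m [|i j] /=.
- by case: m.
- by case: m.
- by apply/allpairsPdep => -[? [? []]].
apply/allpairsPdep/and3P => [[i' [j' [i'_in j'_in [-> ->]]]]|].
  move: i'_in j'_in; rewrite mem_index_iota IHl.
  move=> /andP[i_gt0 le_im] /and3P[/eqP-> ->]; rewrite i_gt0 eqxx => /eqP->.
  by split=> //; rewrite subnKC.
case; rewrite eqSS => sz_j /andP[i_gt0 all_j] /eqP <-.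
exists i, j; split=> //; first by rewrite mem_index_iota i_gt0 ltnS leq_addr.
by rewrite IHl sz_j all_j addKn eqxx.
Qed.

Lemma uniq_compositions_of_size l m : uniq (compositions_of_size l m).
Proof.
elim: l m => [|l IHl] m /=; first by case: eqP.
by apply: allpairs_uniq_dep => [|//|[i j] [i' j'] _ _ [-> ->]]; rewrite ?iota_uniq.
Qed.

Section GeneratingFunction.
Variables (R : idomainType) (P : nat -> R) (Q : {poly R}) (N : nat).
Hypotheses (Q0 : Q`_0 = 0) (QP : forall i, (0 < i <= N)%N -> Q`_i = P i).

(** [Q] stands for the series with coefficients [P i], [i > 0], known up to degree [N]. Splitting
    off the first part of a composition is the convolution of [Q] with [Q ^+ l]; [Q0] discards a
    part equal to 0. *)
Lemma sum_compositions_of_size l m : (m <= N)%N ->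
  \sum_(j <- compositions_of_size l m) \prod_(i <- j) P i = (Q ^+ l)`_m.
Proof.
elim: l m => [|l IHl] m le_mN /=.
  by rewrite coef1; case: eqP; rewrite (big_seq1, big_nil) ?big_nil.
rewrite big_allpairs_dep exprS coefM big_ord_recl Q0 mul0r add0r.
rewrite big_add1 /= big_mkord; apply: eq_bigr => i _.
have lt_im := ltn_ord i.
rewrite -IHl; last by lia.
rewrite big_distrr /=; apply: eq_bigr => j _.
by rewrite big_cons QP // /bump; lia.
Qed.

(** Compositions are grouped by length; a composition of [m] has at most [m] parts, so lengths up to
    [N] suffice. *)
Lemma sum_compositions (w : nat -> R) m : (m <= N)%N ->
  \sum_(j \in compositions m) (w (size j) * \prod_(i <- j) P i)
  = \sum_(l < N.+1) w l * (Q ^+ l)`_m.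
Proof.
move=> le_mN; rewrite fsbig_finite /=; last exact: finite_compositions.
rewrite -(big_mkord xpredT (fun l => w l * (Q ^+ l)`_m)).
transitivity (\sum_(0 <= l < N.+1) \sum_(j <- compositions_of_size l m)
   w (size j) * \prod_(i <- j) P i); last first.
  apply: eq_bigr => l _; rewrite -sum_compositions_of_size // big_distrr.
  apply: eq_big_seq => j; rewrite mem_compositions_of_size.
  by case/and3P => /eqP->.
rewrite -(big_allpairs_dep (h := fun _ j => j)
                           (F := fun j => w (size j) * \prod_(i <- j) P i)).
apply/perm_big/uniq_perm; first exact: fset_uniq.
  apply: allpairs_uniq_dep => [|l _|x y]; first exact: iota_uniq.
    exact: uniq_compositions_of_size.
  move=> /allpairsPdep[l [j [_ + ->]]] /allpairsPdep[l' [j' [_ + ->]]].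
  rewrite !mem_compositions_of_size => /andP[/eqP<- _] /andP[/eqP<- _] /= eq_j.
  by rewrite eq_j.
move=> j; rewrite in_fset_set; last exact: finite_compositions.
apply/idP/allpairsPdep; rewrite inE.
  case=> all_j sum_j; exists (size j), j; split=> //; last first.
    by rewrite mem_compositions_of_size eqxx all_j sum_j /=.
  rewrite mem_index_iota /= ltnS (leq_trans _ le_mN) // -sum_j.
  elim: j all_j {sum_j} => //= i j IHj /andP[i_gt0 /IHj le_j].
  by rewrite -add1n leq_add.
case=> l [j' [_ + ->]]; rewrite mem_compositions_of_size.
by move=> /and3P[_ ? /eqP].
Qed.

End GeneratingFunction.

Lemma coefX_small (R : nzRingType) (Q : {poly R}) l n :
  Q`_0 = 0 -> (n < l)%N -> (Q ^+ l)`_n = 0.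
Proof.
move=> Q0; elim: l n => // l IHl n lt_nl; rewrite exprS coefM big1 // => i _.
case: (posnP i) => [->|i_gt0]; first by rewrite Q0 mul0r.
by rewrite IHl ?mulr0 //; have := ltn_ord i; lia.
Qed.

(** * The logarithm of the generating function and its derivative *)

Section Logarithm.
Variable P : nat -> rat.
Hypothesis P0 : P 0%N = 1.

(* The coefficients of [- log (1 + \sum_(i > 0) P i * X^i)]. *)
Definition log_coef m : rat :=
  \sum_(j \in compositions m) ((-1) ^+ size j / (size j)%:R * \prod_(i <- j) P i).

Lemma log_coef_convolution n : (0 < n)%N ->
  \sum_(1 <= m < n.+1) m%:R * log_coef m * P (n - m)%N = - (n%:R * P n).
Proof.
move=> n_gt0; pose Q : {poly rat} := \poly_(i < n.+1) (if i == 0%N then 0 else P i).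
have Q0 : Q`_0 = 0 by rewrite coef_poly.
have QP i : (0 < i <= n)%N -> Q`_i = P i.
  by case/andP=> i_gt0 le_in; rewrite coef_poly ltnS le_in eqn0Ngt i_gt0.
pose U : {poly rat} := \sum_(l < n) (- Q) ^+ l.
have logE m : (0 < m <= n)%N -> m%:R * log_coef m = - (Q^`() * U)`_m.-1.
  case/andP=> m_gt0 le_mn; rewrite /log_coef.
  rewrite (sum_compositions Q0 QP (fun l => (-1) ^+ l / l%:R)) //.
  (* The term of length 0 drops out because the inverse of 0 is 0; the remaining lengths start at
     1. *)
  rewrite big_ord_recl invr0 mulr0 mul0r add0r !big_distrr /= coef_sum -sumrN.
  apply: eq_bigr => l _; rewrite /bump /= add1n.
  have -> : m%:R * ((-1) ^+ l.+1 / l.+1%:R * (Q ^+ l.+1)`_m) =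
      (-1) ^+ l.+1 / l.+1%:R * ((Q ^+ l.+1)`_m.-1.+1 *+ m.-1.+1).
    by rewrite prednK // -[X in _ = _ * X]mulr_natl; ring.
  rewrite -coef_deriv deriv_exp coefMn /= -[(- Q)]scaleN1r exprZn -scalerAr coefZ.
  rewrite -[X in _ * X = _]mulr_natl mulrA divfK ?pnatr_eq0 //.
  by rewrite exprS mulN1r mulNr.
transitivity (- (Q^`() * U * (1 + Q))`_n.-1).
  rewrite coefM -sumrN prednK // big_add1 /= big_mkord; apply: eq_bigr => m _.
  have lt_mn := ltn_ord m.
  rewrite logE // mulNr; congr (- (_ * _)).
  rewrite (_ : n.-1 - m = n - m.+1)%N; last by lia.
  rewrite coefD coef1; case: eqP => [->|ne]; first by rewrite P0 Q0 addr0.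
  by rewrite add0r QP //; lia.
have eqU : U * (1 + Q) = 1 - (- Q) ^+ n.
  rewrite -[RHS]opprB subrX1 -mulNr mulrC; congr (_ * _).
  by rewrite opprB opprK.
have small : (Q^`() * (- Q) ^+ n)`_n.-1 = 0.
  rewrite coefM big1 // => i _; rewrite [X in _ * X]coefX_small ?mulr0 //.
    by rewrite coefN Q0 oppr0.
  by rewrite (leq_ltn_trans (leq_subr _ _)) // prednK.
rewrite -mulrA eqU mulrBr mulr1 coefB small subr0 coef_deriv prednK // QP //.
  by rewrite mulr_natl.
by rewrite n_gt0 leqnn.
Qed.

(** Since [P 0 = 1], the recurrence gives [L n] in terms of smaller indices, and
    [log_coef_convolution] says that the right-hand side obeys the same recurrence. *)
Lemma convolution_unique (L : nat -> rat) n : (0 < n)%N ->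
  (forall m, (0 < m <= n)%N ->
     m%:R * P m = \sum_(1 <= k < m.+1) L k * P (m - k)%N) ->
  L n = - (n%:R * log_coef n).
Proof.
have [k] := ubnP n; elim: k n => // k IHk n le_nk n_gt0 recL.
have := recL n; rewrite n_gt0 leqnn => /(_ isT).
have := log_coef_convolution n_gt0.
rewrite !big_nat_recr //= subnn P0 !mulr1.
move=> eq1 eq2; apply: (addrI (\sum_(1 <= m < n) L m * P (n - m)%N)).
rewrite -eq2 -[LHS]opprK -eq1 opprD; congr (_ - _).
rewrite -sumrN; apply: eq_big_nat => m /andP[m_gt0 lt_mn].
rewrite -mulNr -IHk //; first by rewrite (leq_trans lt_mn).
by move=> i /andP[i_gt0 le_im]; apply: recL; rewrite i_gt0 (leq_trans le_im) // ltnW.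
Qed.

End Logarithm.

(** * Degree zero and the final formulas *)

Lemma monic_polys_0 (F : finFieldType) r : monic_polys F r 0 = [set 1].
Proof.
apply/seteqP; split=> p /= => [[lead_p /eqP/msize_poly1P[c _ def_p]]|->].
  by move: lead_p; rewrite def_p mleadcC => ->.
by split; rewrite ?mleadc1 ?msize1.
Qed.

Lemma irreducible_polys_0 (F : finFieldType) r : irreducible_polys F r 0 = set0.
Proof. by apply/seteqP; split=> // p /irreducible_polys_gt0. Qed.

Lemma card_irred_reducible (F : finFieldType) r n :
  (#|` fset_set (irreducible_polys F r n)| + #|` fset_set (reducible_polys F r n)|
   = #|` fset_set (monic_polys F r n)|)%N.
Proof.
rewrite /reducible_polys fset_setD; last 2 first.
- exact: finite_monic_polys.
- exact: finite_irreducible_polys.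
have sub_irr :
    (fset_set (irreducible_polys F r n) `<=` fset_set (monic_polys F r n))%fset.
  rewrite -fset_set_sub; [by move=> p []|exact: finite_irreducible_polys|].
  exact: finite_monic_polys.
by rewrite cardfsDS // subnKC // fsubset_leq_card.
Qed.

Theorem theorem3p1 (r q : nat) (F : finFieldType)
    (hr : (1 <= r)%N) (hq : #|F| = q) :
  [/\ #|` fset_set (irreducible_polys F r 0)| = 0%N,
      #|` fset_set (reducible_polys F r 0)| = 1%N &
      forall n : nat, (1 <= n)%N ->
        (#|` fset_set (irreducible_polys F r n)|%:R : rat) =
          - (\sum_(k <- divisors n) (moebius k)%:~R / k%:R *
               \sum_(j \in compositions (n %/ k)%N)
                 ((-1) ^+ size j / (size j)%:R *
                  \prod_(i <- j) monic_count q r i))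
        /\
        (#|` fset_set (reducible_polys F r n)|%:R : rat) =
          monic_count q r n +
          \sum_(k <- divisors n) (moebius k)%:~R / k%:R *
               \sum_(j \in compositions (n %/ k)%N)
                 ((-1) ^+ size j / (size j)%:R *
                  \prod_(i <- j) monic_count q r i)].
Proof.
(* The count [monic_countE] is stated for [r.+1] variables. *)
case: r hr => // r _; subst q.
have card_irr0 : #|` fset_set (irreducible_polys F r.+1 0)| = 0%N.
  by rewrite irreducible_polys_0 fset_set0 cardfs0.
have card_monic0 : #|` fset_set (monic_polys F r.+1 0)| = 1%N.
  by rewrite monic_polys_0 fset_set1 cardfs1.
split=> // [|n n_gt0].
  by rewrite -card_monic0 -card_irred_reducible card_irr0.
pose P := monic_count #|F| r.+1.
have P0 : P 0%N = 1 by rewrite /P monic_countE card_monic0.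
have weightE m : (0 < m)%N ->
    - (m%:R * log_coef P m) = (irred_weight F r.+1 m)%:R.
  move=> m_gt0; apply/esym.
  apply: (convolution_unique P0 (L := fun m => (irred_weight F r.+1 m)%:R)) => // k _.
  rewrite /P monic_countE -natrM monic_count_convolution natr_sum.
  by apply: eq_bigr => i _; rewrite natrM monic_countE.
have irrE : (#|` fset_set (irreducible_polys F r.+1 n)|%:R : rat) =
    - (\sum_(k <- divisors n) (moebius k)%:~R / k%:R * log_coef P (n %/ k)).
  have nz_n : n%:R != 0 :> rat by rewrite pnatr_eq0 -lt0n.
  (* The degree [d] is a weight in [irred_weight], so inversion yields [n] times the number of
     irreducibles. *)
  apply: (mulfI nz_n).
  rewrite (@moebius_inversion _ (fun d =>
      d%:R * #|` fset_set (irreducible_polys F r.+1 d)|%:R)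
    (fun m => (irred_weight F r.+1 m)%:R)) // => [|m _]; last first.
    by rewrite /irred_weight natr_sum; apply: eq_bigr => d _; rewrite natrM.
  rewrite mulrN big_distrr -sumrN /=; apply: eq_big_seq => k.
  rewrite -dvdn_divisors // => dvd_kn; have k_gt0 := dvdn_gt0 n_gt0 dvd_kn.
  have nk_gt0 : (0 < n %/ k)%N by rewrite divn_gt0 // dvdn_leq.
  have nz_k : k%:R != 0 :> rat by rewrite pnatr_eq0 -lt0n.
  rewrite -(weightE _ nk_gt0) mulrN; congr (- _).
  (* Dividing the factor [n %/ k] from [weightE] by [n] leaves the 1 / k of the formula. *)
  have -> : n%:R = (n %/ k)%:R * k%:R :> rat by rewrite -natrM divnK.
  move: (_%:~R : rat) (_%:R : rat) (_%:R : rat) (log_coef _ _) nz_k => a b c x nz_c.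
  by field.
split; first exact: irrE.
have -> : (#|` fset_set (reducible_polys F r.+1 n)|%:R : rat) =
    P n - #|` fset_set (irreducible_polys F r.+1 n)|%:R.
  by rewrite /P monic_countE -card_irred_reducible natrD addrC addKr.
by rewrite irrE opprK.
Qed.
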